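(* Let $\rho$ be a probability measure on $\mathbb{R}$ having moments of all orders, i.e. $\int |x|^n\,d\rho(x)<\infty$ for all $n\geq 1$, and put $m_n=\int_{\mathbb{R}} x^n\,d\rho(x)$ for $n\geq 0$ (so $m_0=1$). Suppose that at least one of the following holds: (i) the limit $R=\lim_{n\to+\infty}|n!/m_n|^{1/n}$ exists in $[0,+\infty]$ and $R>0$ (with $n!/0$ read as $+\infty$); (ii) the power series $\sum_{n=0}^{+\infty} m_n x^n/n!$ has a positive radius of convergence. Then the moments determine $\rho$: if $\rho_1$ is any probability measure on $\mathbb{R}$ having moments of all orders with $\int_{\mathbb{R}} x^n\,d\rho_1(x)=m_n$ for all $n\geq 1$, then $\rho_1=\rho$.
   Context: Probability measures on $\mathbb{R}$ are defined on the Borel $\sigma$-algebra. *)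

(* Defs.v *)
(* MathComp-Analysis; the real line is an arbitrary [R : realType]. *)
From mathcomp Require Import all_boot all_order all_algebra.
From mathcomp Require Import all_classical all_reals all_analysis.

Set Implicit Arguments.
Unset Strict Implicit.
Unset Printing Implicit Defensive.

Import Order.TTheory GRing.Theory Num.Theory.
Import numFieldNormedType.Exports.

Local Open Scope classical_set_scope.
Local Open Scope ring_scope.

Definition finite_moments (R : realType)
    (rho : probability (measurableTypeR R) R) : Prop :=
  forall n : nat, (1 <= n)%N ->
    (\int[rho]_x (`|(x : R)| ^+ n)%:E < +oo)%E.

(* [Rintegral] is the real part of the extended-real integral: this is the
   n-th moment as soon as [x ^+ n] is integrable, see [finite_moments]. *)
Definition moment (R : realType)
    (rho : probability (measurableTypeR R) R) (n : nat) : R :=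
  (\int[rho]_x ((x : R) ^+ n))%R.

(* The division is that of extended reals, where 0^-1 = +oo and hence
   n! / 0 = +oo; also +oo `^ r = +oo for r > 0.  The term of index 0 is a
   junk value, since n%:R^-1 = 0 there. *)
Definition moment_root_ratio (R : realType) (m : nat -> R) (n : nat) : \bar R :=
  (`| (n`!%:R)%:E / (m n)%:E | `^ (n%:R^-1)%R)%E.

Definition radius_of_convergence (R : realType) (a : nat -> R) : \bar R :=
  ereal_sup [set (`|x|)%:E | x in [set x : R | cvgn (pseries a x)]].

(* Main.v *)
(** Either hypothesis gives [|m_n| <= M n! / c^n]; expanding
    [e^(t x) + e^(- t x)], whose Taylor terms are nonnegative, and integrating
    termwise shows that [e^(t |x|)] is integrable for both measures when
    [0 < t < c].
    Let [W] be the space of bounded measurable [f] such that all moments of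
    [f rho] and [f rho1] agree; it contains [1].  The multipliers of [W], i.e.
    the [h] with [h W] included in [W], form an algebra that is closed under
    bounded pointwise limits, hence under composition with [exp].  For small
    [t] it contains [sin (t x)], by integrating the Taylor series under the domination by [e^(t |x|)].
    Since [sin (t x) / t --> x] as [t --> 0], it contains
    [exp (- exp (n (1 - n (x - a))))], and letting [n --> oo] the indicator of
    the open half-line [x > a].  Hence [rho] and [rho1] agree on these
    half-lines, which form a pi-system generating the Borel sets. *)
Require Import Defs.
From mathcomp Require Import all_boot all_order all_algebra.
From mathcomp Require Import all_classical all_reals all_analysis.
From mathcomp Require Import measurable_realfun ring.

Set Implicit Arguments.
Unset Strict Implicit.
Unset Printing Implicit Defensive.

Import Order.TTheory GRing.Theory Num.Theory.
Import numFieldNormedType.Exports.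

Local Open Scope classical_set_scope.
Local Open Scope ring_scope.

(** * Functions with equal integrals under two measures *)

Section agree.
Context d (T : measurableType d) (R : realType).
Variables mu nu : {measure set T -> \bar R}.
Implicit Types f g : T -> R.

Definition agree f := [/\ mu.-integrable setT (EFin \o f),
  nu.-integrable setT (EFin \o f) & \int[mu]_x f x = \int[nu]_x f x].

Lemma agreeD f g : agree f -> agree g -> agree (fun x => f x + g x).
Proof.
move=> [mf nf fE] [mg ng gE]; split.
- by apply: eq_integrable (integrableD _ mf mg).
- by apply: eq_integrable (integrableD _ nf ng).
- by rewrite !RintegralD// fE gE.
Qed.

Lemma agreeZ c f : agree f -> agree (fun x => c * f x).
Proof.
move=> [mf nf fE]; split.
- by apply: eq_integrable (integrableZl _ c mf).
- by apply: eq_integrable (integrableZl _ c nf).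
- by rewrite !RintegralZl// fE.
Qed.

Lemma agree_sum I (s : seq I) (f : I -> T -> R) :
  (forall i, agree (f i)) -> agree (fun x => \sum_(i <- s) f i x).
Proof.
move=> af; elim: s => [|i s IHs].
  under eq_fun do rewrite big_nil.
  split; [exact: integrable0 | exact: integrable0 |].
  by rewrite /Rintegral !integral0.
under eq_fun do rewrite big_cons.
exact: agreeD.
Qed.

Lemma cvg_Rintegral_dominated (m : {measure set T -> \bar R})
    (f_ : nat -> T -> R) f g :
  (forall n, measurable_fun setT (f_ n)) -> measurable_fun setT f ->
  (forall x, f_ ^~ x @ \oo --> f x) -> m.-integrable setT (EFin \o g) ->
  (forall n x, `|f_ n x| <= g x) ->
  m.-integrable setT (EFin \o f) /\
  \int[m]_x f_ n x @[n --> \oo] --> \int[m]_x f x.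
Proof.
move=> mf_ mf f_f ig f_g.
have emf_ n : measurable_fun setT (EFin \o f_ n) by apply/measurable_EFinP.
have emf : measurable_fun setT (EFin \o f) by apply/measurable_EFinP.
have f_f' : {ae m, forall x, setT x ->
    (EFin \o f_ n) x @[n --> \oo] --> (f x)%:E}.
  by apply: aeW => x _; apply: cvg_EFin; [exact: nearW | exact: f_f].
have f_g' : {ae m, forall x n, setT x -> (`|(EFin \o f_ n) x| <= (g x)%:E)%E}.
  by apply: aeW => x n _; rewrite /= lee_fin.
have [iF _ cF] := dominated_convergence measurableT emf_ emf f_f' ig f_g'.
split => //.
apply: fine_cvg; rewrite fineK//.
exact: integrable_fin_num.
Qed.

(** Dominated convergence under each measure, with one [g] serving both, makes the two integrals of
    [f] limits of the same real sequence. *)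
Lemma agree_lim (f_ : nat -> T -> R) f g :
  (forall n, agree (f_ n)) -> (forall x, f_ ^~ x @ \oo --> f x) ->
  mu.-integrable setT (EFin \o g) -> nu.-integrable setT (EFin \o g) ->
  (forall n x, `|f_ n x| <= g x) -> agree f.
Proof.
move=> af f_f mg ng f_g.
have mf_ n : measurable_fun setT (f_ n).
  by have [/measurable_int/measurable_EFinP] := af n.
have mf : measurable_fun setT f.
  exact: (measurable_fun_cvg mf_ (fun x _ => f_f x)).
have [imu cmu] := cvg_Rintegral_dominated mf_ mf f_f mg f_g.
have [inu cnu] := cvg_Rintegral_dominated mf_ mf f_f ng f_g.
have fE : (fun n => \int[mu]_x f_ n x) = (fun n => \int[nu]_x f_ n x).
  by apply/funext => n; have [] := af n.
by split => //; rewrite fE in cmu; exact: cvg_unique cmu cnu.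
Qed.

End agree.

(** * Exponential bounds on partial Taylor sums *)

Section exp_bound.
Context {R : realType}.
Implicit Types (x : R) (u : nat -> R).

Lemma norm_exp_coeff x i : `|exp_coeff x i| = exp_coeff `|x| i.
Proof. by rewrite /exp_coeff /= normrM normfV normrX normr_nat. Qed.

(** The partial sums of the exponential series increase to their limit, so the bound is uniform in
    [n]; it supplies the domination for the series of both [expR] and [sin]. *)
Lemma norm_series_le_expR u x n :
  (forall i, `|u i| <= exp_coeff `|x| i) -> `|series u n| <= expR `|x|.
Proof.
move=> ux; apply: (@le_trans _ _ (series (exp_coeff `|x|) n)).
  by rewrite (le_trans (ler_norm_sum _ _ _))// ler_sum.
apply: nondecreasing_cvgn_le; last exact: is_cvg_series_exp_coeff.
by apply: nondecreasing_series => i _ _; exact: exp_coeff_ge0.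
Qed.

Lemma norm_sin_coeff x i : `|sin_coeff x i| <= exp_coeff `|x| i.
Proof.
rewrite -norm_exp_coeff /sin_coeff /exp_coeff /= -2!mulrA normrM normrMsign.
by case: odd; rewrite ?normr1 ?mul1r// normr0 mul0r.
Qed.

End exp_bound.

(** * The algebra of multipliers *)

Section multiplier.
Variable R : realType.
Local Notation T := (measurableTypeR R).
Variables mu nu : {measure set T -> \bar R}.
Implicit Types f g h : T -> R.

Definition bounded_measurable h :=
  measurable_fun setT h /\ exists M, forall x, `|h x| <= M.

(** The space W. Agreement is asked for every power [k] because multiplying by a Taylor term of the
    sine raises the power of [x]. *)
Definition moments_agree f := bounded_measurable f /\
  forall k, agree mu nu (fun x : T => (x : R) ^+ k * f x).

Definition multiplier h := bounded_measurable h /\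
  forall f, moments_agree f -> moments_agree (fun x => h x * f x).

Lemma bounded_measurableD f g : bounded_measurable f -> bounded_measurable g ->
  bounded_measurable (fun x => f x + g x).
Proof.
move=> [mf [M fM]] [mg [N gN]]; split; first exact: measurable_funD.
exists (M + N) => x; rewrite (le_trans (ler_normD _ _))// lerD//.
Qed.

Lemma bounded_measurableM f g : bounded_measurable f -> bounded_measurable g ->
  bounded_measurable (fun x => f x * g x).
Proof.
move=> [mf [M fM]] [mg [N gN]]; split; first exact: measurable_funM.
by exists (M * N) => x; rewrite normrM ler_pM.
Qed.

Lemma multiplier_cst c : multiplier (cst c).
Proof.
have bc : bounded_measurable (cst c) by split => //; exists `|c|.
split => // f [bf af]; split => [|k]; first exact: bounded_measurableM.
by under eq_fun do rewrite mulrCA; exact: agreeZ.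
Qed.

Lemma multiplierD g h : multiplier g -> multiplier h ->
  multiplier (fun x => g x + h x).
Proof.
move=> [bg ag] [bh ah]; split=> [|f wf]; first exact: bounded_measurableD.
have [bgf agf] := ag _ wf; have [bhf ahf] := ah _ wf.
under eq_fun do rewrite mulrDl.
split=> [|k]; first exact: bounded_measurableD.
by under eq_fun do rewrite mulrDr; exact: agreeD.
Qed.

Lemma multiplierM g h : multiplier g -> multiplier h ->
  multiplier (fun x => g x * h x).
Proof.
move=> [bg ag] [bh ah]; split=> [|f wf]; first exact: bounded_measurableM.
by under eq_fun do rewrite -mulrA; apply/ag/ah.
Qed.

Lemma multiplierX h n : multiplier h -> multiplier (fun x => h x ^+ n).
Proof.
move=> mh; elim: n => [|n IHn].
  by under eq_fun do rewrite expr0; exact: multiplier_cst.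
by under eq_fun do rewrite exprS; exact: multiplierM.
Qed.

Lemma multiplier_sum I (s : seq I) (h : I -> T -> R) :
  (forall i, multiplier (h i)) -> multiplier (fun x => \sum_(i <- s) h i x).
Proof.
move=> mh; elim: s => [|i s IHs].
  by under eq_fun do rewrite big_nil; exact: multiplier_cst.
by under eq_fun do rewrite big_cons; exact: multiplierD.
Qed.

Hypothesis muX : forall k,
  mu.-integrable setT (fun x : T => (`|x : R| ^+ k)%:E).
Hypothesis nuX : forall k,
  nu.-integrable setT (fun x : T => (`|x : R| ^+ k)%:E).

Lemma multiplier_lim (h_ : nat -> T -> R) h M :
  (forall n, multiplier (h_ n)) -> (forall n x, `|h_ n x| <= M) ->
  (forall x, h_ ^~ x @ \oo --> h x) -> multiplier h.
Proof.
move=> mh h_M h_h.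
have bh : bounded_measurable h.
  split.
    apply: (@measurable_fun_cvg _ _ _ setT h_ h) => [n|x _]; last exact: h_h.
    by have [[]] := mh n.
  exists M => x.
  have : `|h_ n x| @[n --> \oo] --> `|h x| by exact: cvg_norm.
  by move=> hc; apply: (cvgr_to_le hc); apply: nearW => n; exact: h_M.
split => // f wf; have [bf _] := wf.
split=> [|k]; first exact: bounded_measurableM.
have [mf [N fN]] := bf.
apply: (@agree_lim _ _ _ mu nu (fun n x => (x : R) ^+ k * (h_ n x * f x))
  _ (fun x => (M * N) * `|x : R| ^+ k)).
- by move=> n; have [_ /(_ _ wf)[_]] := mh n.
- by move=> x; apply: cvgMl_tmp; apply: cvgMr_tmp; exact: h_h.
- exact: (integrableZl measurableT (M * N) (muX k)).
- exact: (integrableZl measurableT (M * N) (nuX k)).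
- move=> n x; rewrite !normrM normrX mulrC ler_wpM2r ?exprn_ge0//.
  by rewrite ler_pM.
Qed.

(** The partial sums of the exponential series are polynomials in [h], hence multipliers, and are
    bounded by [expR M] when [M] bounds [h]. *)
Lemma multiplier_expR h : multiplier h -> multiplier (fun x => expR (h x)).
Proof.
move=> mh; have [[_ [M hM]] _] := mh.
apply: (@multiplier_lim (fun n x => series (exp_coeff (h x)) n) _ (expR M)).
- move=> n; rewrite /series /exp_coeff /=; apply: multiplier_sum => i.
  apply: (multiplierM _ (multiplier_cst _)); exact: multiplierX.
- move=> n x; apply: (@le_trans _ _ (expR `|h x|)); last by rewrite ler_expR.
  by apply: norm_series_le_expR => i; rewrite norm_exp_coeff.
- move=> x; exact: is_cvg_series_exp_coeff.
Qed.

Lemma multiplier_sin t :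
  (forall k, mu.-integrable setT
    (fun x : T => (`|x : R| ^+ k * expR `|t * x|)%:E)) ->
  (forall k, nu.-integrable setT
    (fun x : T => (`|x : R| ^+ k * expR `|t * x|)%:E)) ->
  multiplier (fun x => sin (t * x)).
Proof.
move=> muE nuE.
have bs : bounded_measurable (fun x => sin (t * x)).
  split; last by exists 1 => x; exact: sin_max.
  apply: continuous_measurable_fun => x.
  apply: continuous_comp; first exact: mulrl_continuous.
  exact: continuous_sin.
split => // f [bf af]; split=> [|k]; first exact: bounded_measurableM.
have [mf [N fN]] := bf.
apply: (@agree_lim _ _ _ mu nu
  (fun n x => (x : R) ^+ k * (series (sin_coeff (t * x)) n * f x))
  _ (fun x => N * (`|x : R| ^+ k * expR `|t * x|))).
- move=> n; rewrite /series /=.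
  under eq_fun do rewrite mulr_suml mulr_sumr.
  apply: agree_sum => i.
  (* The [i]-th Taylor term only shifts the power: what remains is a multiple of
     [x ^+ (k + i) * f x], which agrees since [f] is in W. *)
  rewrite [X in agree _ _ X](_ : _ = fun x =>
    (odd i)%:R * (-1) ^+ i.-1./2 * t ^+ i / i`!%:R * (x ^+ (k + i) * f x)).
    exact: agreeZ.
  by apply/funext => x; rewrite /sin_coeff /= exprMn exprD; ring.
- move=> x; apply: cvgMl_tmp; apply: cvgMr_tmp.
  rewrite sin.unlock; exact: is_cvg_series_sin_coeff.
- exact: (integrableZl measurableT N (muE k)).
- exact: (integrableZl measurableT N (nuE k)).
- move=> n x; rewrite [leRHS]mulrCA 2![in leLHS]normrM normrX.
  rewrite ler_wpM2l ?exprn_ge0// mulrC.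
  apply: ler_pM; [exact: normr_ge0|exact: normr_ge0|exact: fN|].
  by apply: norm_series_le_expR => i; exact: norm_sin_coeff.
Qed.

End multiplier.

(** * Two pointwise limits *)

Section limits.
Variable R : realType.
Local Notation T := (measurableTypeR R).

(** These are difference quotients at 0 of [sin (h * x)] in [h], whose derivative there is
    [cos 0 * x]. *)
Lemma cvg_sin_slope (t_ : nat -> R) (x : R) : (forall n, t_ n != 0) ->
  t_ @ \oo --> 0 -> sin (t_ n * x) / t_ n @[n --> \oo] --> x.
Proof.
move=> t0 tcvg.
have dsin : is_derive (0 : R) 1 (sin \o ( *%R^~ x)) x.
  rewrite -[X in is_derive _ _ _ X]mul1r -[X in X * _](@cos0 R).
  rewrite -[X in cos X](mul0r x).
  apply: is_derive1_comp.
  have := is_deriveM (is_derive_id (0:R) (1:R)) (is_derive_cst x (0:R) (1:R)).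
  by rewrite scaler0 add0r /GRing.scale/= mulr1.
have [dv dvE] := dsin.
have dcvg : h^-1 *: (((sin \o ( *%R^~ x)) \o shift 0) (h *: 1)
    - (sin \o ( *%R^~ x)) 0) @[h --> (0:R)^'] --> x.
  by rewrite -[X in _ --> X]dvE.
have /cvgr_dnbhsP/(_ t_ (conj t0 tcvg)) := dcvg.
apply: cvg_trans; apply: near_eq_cvg; apply: nearW => n.
by rewrite /= addr0 mul0r sin0 subr0 /GRing.scale/= mulr1 mulrC.
Qed.

(* The extra term [n] in the exponent makes the limit at [x = a] equal to [0]
   instead of [exp (- 1)]. *)
Lemma cvg_double_exp (a x : R) :
  expR (- expR (n%:R * (1 - n%:R * (x - a)))) @[n --> \oo]
    --> (\1_(`]a, +oo[) x : R).
Proof.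
rewrite indicE mem_setE in_itv/= andbT.
have [ax|xa] := ltP a x.
  (* Once [n * (x - a) >= 2] the inner exponent is at most [- n], and [1 + y <= expR y] gives this
     lower bound. *)
  have cn : (1 - expR (- n%:R) : R) @[n --> \oo] --> (1 : R).
    rewrite -[X in _ --> X]subr0; apply: cvgB;
      [exact: cvg_cst|exact: cvgn_expR].
  apply: (squeeze_cvgr _ cn); [|exact: cvg_cst].
  near=> n; apply/andP; split; last by rewrite expR_le1 oppr_le0 expR_ge0.
  rewrite (le_trans _ (expR_ge1Dx _))// lerD2l lerN2 ler_expR.
  rewrite -mulrN1 ler_wpM2l// lerBlDr addrC -lerBlDr opprK.
  rewrite -ler_pdivrMr ?subr_gt0//.
  near: n; exact: nbhs_infty_ger.
(* For [x <= a] the inner exponent is at least [n], so the value lies between 0 and [expR (- n)]. *)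
have c0 : (0 : R) @[n --> \oo] --> (0 : R) by exact: cvg_cst.
apply: (squeeze_cvgr _ c0); [|exact: (@cvgn_expR R)].
apply: nearW => n; rewrite expR_ge0/= ler_expR lerN2.
apply: (le_trans _ (expR_ge1Dx _)); rewrite addrC ler_wpDr//.
rewrite ler_peMr// lerBrDr gerDl.
by rewrite mulr_ge0_le0// subr_le0.
Unshelve. all: by end_near. Qed.

End limits.

(** * Half-line indicators and exponential integrability *)

Section moment_generating.
Variable R : realType.
Local Notation T := (measurableTypeR R).
Implicit Types mu nu : {measure set T -> \bar R}.

(** The functions [sin (t * x) / t] have no common bound as [t] tends to 0, but [expR (- expR y)]
    stays in [0, 1] for every [y]. Hence [multiplier_lim] applies with bound 1 twice: first as
    [t_ m] tends to 0 for fixed [n], then in [n]. *)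
Lemma multiplier_itv mu nu (e a : R) : 0 < e ->
  (forall t k, `|t| <= e -> mu.-integrable setT
    (fun x : T => (`|x : R| ^+ k * expR `|t * x|)%:E)) ->
  (forall t k, `|t| <= e -> nu.-integrable setT
    (fun x : T => (`|x : R| ^+ k * expR `|t * x|)%:E)) ->
  multiplier mu nu (\1_(`]a, +oo[) : T -> R).
Proof.
move=> e0 muE nuE.
have X (m : {measure set T -> \bar R}) :
    (forall t k, `|t| <= e -> m.-integrable setT
      (fun x : T => (`|x : R| ^+ k * expR `|t * x|)%:E)) ->
    forall k, m.-integrable setT (fun x : T => (`|x : R| ^+ k)%:E).
  move=> mE k; have := mE 0 k; rewrite normr0 ltW// => /(_ isT).
  by under eq_fun do rewrite mul0r normr0 expR0 mulr1.
have le1 (y : R) : `|expR (- expR y)| <= 1.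
  by rewrite ger0_norm ?expR_ge0// expR_le1 oppr_le0 expR_ge0.
apply: (@multiplier_lim _ _ _ (X _ muE) (X _ nuE)
  (fun n x => expR (- expR (n%:R * (1 - n%:R * (x - a))))) _ 1)
  => //; last first.
  by move=> x; exact: cvg_double_exp.
move=> n; pose t_ m := e / m.+1%:R.
have t_gt0 m : 0 < t_ m by rewrite divr_gt0.
have t_cvg : t_ @ \oo --> 0.
  rewrite -[X in _ --> X](mulr0 e); apply: cvgMl_tmp; exact: cvg_harmonic.
apply: (@multiplier_lim _ _ _ (X _ muE) (X _ nuE)
  (fun m x =>
    expR (- expR (n%:R * (1 - n%:R * (sin (t_ m * x) / t_ m - a))))) _ 1)
  => //; last first.
  move=> x.
  have cs : sin (t_ m * x) / t_ m @[m --> \oo] --> x.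
    by apply: cvg_sin_slope => // m; rewrite gt_eqF.
  apply: continuous_cvg; first exact: continuous_expR.
  apply: cvgN; apply: continuous_cvg; first exact: continuous_expR.
  apply: cvgMl_tmp; apply: cvgB; first exact: cvg_cst.
  by apply: cvgMl_tmp; apply: cvgB => //; exact: cvg_cst.
move=> m.
have t_le : `|t_ m| <= e.
  by rewrite gtr0_norm// /t_ ler_pdivrMr// -[leLHS]mulr1 ler_pM2l// ler1n.
have msin : multiplier mu nu (fun x : T => sin (t_ m * x)).
  by apply: multiplier_sin => k; [exact: muE|exact: nuE].
apply: multiplier_expR; [exact: X|exact: X|].
under eq_fun do rewrite -mulN1r.
apply: multiplierM; first exact: multiplier_cst.
apply: multiplier_expR; [exact: X|exact: X|].
(* The inner exponent is affine in [sin (t_ m * x)]. *)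
rewrite (_ : (fun x => _) = (fun x : T =>
  - (n%:R ^+ 2 / t_ m) * sin (t_ m * x) + (n%:R + n%:R ^+ 2 * a)));
  last by apply/funext => x; ring.
apply: multiplierD; last exact: multiplier_cst.
by apply: multiplierM => //; exact: multiplier_cst.
Qed.

(** Termwise integration of the series of [e^(t x) + e^(- t x)] is dominated by a geometric series
    of ratio [t / c < 1]. *)
Lemma integrable_expR_normM (mu : probability T R) (c M t : R) :
  (forall n, mu.-integrable setT (fun x : T => (`|x : R| ^+ n)%:E)) ->
  (forall n, `|\int[mu]_x ((x : R) ^+ n)| <= M * n`!%:R / c ^+ n) ->
  0 < t < c -> mu.-integrable setT (fun x : T => (expR (t * `|x : R|))%:E).
Proof.
move=> muX mom /andP[t0 tc].
have c0 : 0 < c := lt_trans t0 tc.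
have M0 : 0 <= M.
  by have := mom 0; rewrite fact0 expr0 mulr1 divr1; exact: le_trans.
(* Odd terms cancel and even ones are nonnegative, so sum and integral may be exchanged, and only
   the signed moments enter. *)
pose g n (x : T) : R :=
  exp_coeff (t * (x : R)) n + exp_coeff (- (t * (x : R))) n.
have gE n : g n = fun x => (t ^+ n / n`!%:R * (1 + (-1) ^+ n)) * (x : R) ^+ n.
  by apply/funext => x; rewrite /g /exp_coeff /= (exprNn (t * _)) exprMn; ring.
have mX n : measurable_fun setT (fun x : T => (x : R) ^+ n).
  exact: measurable_funX.
have g0 n x : 0 <= g n x.
  rewrite /g /exp_coeff /= exprNn -mulrA -[X in X + _]mul1r -mulrDl.
  have [nodd|nev] := boolP (odd n); rewrite -signr_odd.
    by rewrite nodd expr1 subrr mul0r.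
  rewrite (negbTE nev) expr0 mulr_ge0// divr_ge0//.
  rewrite -(odd_double_half n) (negbTE nev) add0n -muln2 mulnC exprM.
  by rewrite exprn_ge0// sqr_ge0.
have mg n : measurable_fun setT (g n).
  by rewrite gE; exact: measurable_funM.
have mexp s : measurable_fun setT (fun x : T => expR (s * (x : R))).
  by apply: measurableT_comp; [exact: measurable_expR|exact: measurable_funM].
have gsum x : (\sum_(0 <= n <oo) (g n x)%:E)%E =
    (expR (t * (x : R)) + expR (- (t * (x : R))))%:E.
  apply/cvg_lim => //.
  rewrite (_ : (fun n => _) = EFin \o series (g ^~ x)); last first.
    by apply/funext => n; rewrite /series /= sumEFin.
  apply: cvg_EFin; first exact: nearW.
  rewrite (_ : _ \o _ =
      series (exp_coeff (t * x)) \+ series (exp_coeff (- (t * x)))).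
    by apply: cvgD; exact: is_cvg_series_exp_coeff.
  by apply/funext => n; rewrite /series /g /= -big_split.
have iX n : mu.-integrable setT (fun x : T => ((x : R) ^+ n)%:E).
  apply: le_integrable (muX n) => //; first exact/measurable_EFinP.
  by move=> x _; rewrite /= lee_fin !normrX normr_id.
(* The factor [n!] of the moment bound cancels the Taylor denominator; the 2 bounds
   [1 + (-1) ^+ n]. *)
have gint n : (\int[mu]_x (g n x)%:E <= (2 * M * (t / c) ^+ n)%:E)%E.
  have -> : (\int[mu]_x (g n x)%:E)%E = (\int[mu]_x g n x)%:E.
    rewrite /Rintegral fineK//; apply: integrable_fin_num => //.
    by rewrite gE; apply: (integrableZl measurableT _ (iX n)).
  rewrite gE RintegralZl//; last exact: iX.
  rewrite lee_fin (le_trans (ler_norm _))//.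
  rewrite normrM.
  apply: (@le_trans _ _ (t ^+ n / n`!%:R * 2 * (M * n`!%:R / c ^+ n))).
    apply: ler_pM => //.
    rewrite normrM ler_pM//.
      by rewrite ger0_norm// divr_ge0// exprn_ge0// ltW.
    by rewrite (le_trans (ler_normD _ _))// normr1 normrX normrN1 expr1n.
  rewrite le_eqVlt; apply/orP; left; apply/eqP.
  rewrite expr_div_n; field.
  by rewrite expf_neq0 ?gt_eqF//= pnatr_eq0 -lt0n fact_gt0.
apply: (@le_integrable _ _ _ mu setT measurableT _
  (fun x : T => (expR (t * (x : R)) + expR (- (t * (x : R))))%:E)).
- apply/measurable_EFinP; apply: measurableT_comp => //.
  by apply: measurable_funM => //; exact: measurableT_comp.
- move=> x _; rewrite /= lee_fin (ger0_norm (expR_ge0 _)).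
  rewrite [leRHS]ger0_norm ?addr_ge0 ?expR_ge0//.
  have [x0|x0] := leP 0 x; first by rewrite ger0_norm// lerDl expR_ge0.
  by rewrite ltr0_norm// mulrN lerDr expR_ge0.
apply/integrableP; split.
  apply/measurable_EFinP; apply: measurable_funD; first exact: mexp.
  under eq_fun do rewrite -mulNr.
  exact: mexp.
under eq_integral => x _ do
  rewrite gee0_abs ?lee_fin ?addr_ge0 ?expR_ge0// -gsum.
rewrite integral_nneseries//; last 2 first.
- by move=> n; exact/measurable_EFinP.
- by move=> n x _; rewrite lee_fin.
apply: (@le_lt_trans _ _ (2 * M * (1 - t / c)^-1)%:E); last exact: ltry.
apply: lime_le.
  apply: is_cvg_nneseries => n _ _.
  by apply: integral_ge0 => x _; rewrite lee_fin.
apply: nearW => n.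
apply: (@le_trans _ _ (series (geometric (2 * M) (t / c)) n)%:E).
  rewrite /series/= -sumEFin; apply: lee_sum => i _; exact: gint.
rewrite lee_fin geometric_le_lim ?mulr_ge0 ?divr_gt0//.
by rewrite gtr0_norm ?divr_gt0// ltr_pdivrMr// mul1r.
Qed.

(** The gap [d = s - |t|] absorbs the power: a single term of the exponential series gives
    [|x|^k <= k! / d^k * e^(d |x|)]. *)
Lemma integrable_exprM_expR (mu : {measure set T -> \bar R}) (s t : R) k :
  mu.-integrable setT (fun x : T => (expR (s * `|x : R|))%:E) -> `|t| < s ->
  mu.-integrable setT (fun x : T => (`|x : R| ^+ k * expR `|t * x|)%:E).
Proof.
move=> ms ts; have d0 : 0 < s - `|t| by rewrite subr_gt0.
apply: le_integrable (integrableZl _ (k`!%:R / (s - `|t|) ^+ k) ms) => //.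
  apply/measurable_EFinP; apply: measurable_funM.
    by apply: measurable_funX.
  apply: (measurableT_comp (@measurable_expR R)).
  by apply: measurableT_comp => //; exact: measurable_funM.
move=> x _; rewrite /= lee_fin [leRHS]ger0_norm; last first.
  by rewrite mulr_ge0 ?expR_ge0// divr_ge0// exprn_ge0// ltW.
rewrite normrM normrX normr_id (ger0_norm (expR_ge0 _)).
rewrite normrM (_ : s * `|x| = (s - `|t|) * `|x| + `|t| * `|x|); last by ring.
rewrite expRD mulrA ler_wpM2r ?expR_ge0//.
rewrite mulrAC ler_pdivlMr ?exprn_gt0// -exprMn mulrC.
rewrite [leRHS]mulrC -ler_pdivrMr ?ltr0n ?fact_gt0//.
(* [expR_ge1Dxn] bounds a term of positive degree, so degree 0 is treated apart. *)
case: k => [|k].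
  by rewrite expr0 divr1 -[leLHS]expR0 ler_expR mulr_ge0// ltW.
apply: (@le_trans _ _ (1 + ((s - `|t|) * `|x|) ^+ k.+1 / k.+1`!%:R)).
  by rewrite -subr_ge0 addrK ler01.
by rewrite expR_ge1Dxn// mulr_ge0// ltW.
Qed.

End moment_generating.

(** * From half-lines to all Borel sets *)

Section determinacy.
Variable R : realType.
Local Notation T := (measurableTypeR R).

Lemma probability_itv_unique (mu nu : probability T R) :
  (forall a : R, mu `]a, +oo[%classic = nu `]a, +oo[%classic) ->
  forall A : set T, measurable A -> mu A = nu A.
Proof.
move=> munu; apply: (@measure_unique _ R T (@RGenOInfty.G R)
  (fun n => `]- (n%:R : R), +oo[%classic) _ _ _ _ mu nu).
- exact: RGenOInfty.measurableE.
- move=> _ _ [a ->] [b ->]; exists (Num.max a b).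
  apply/predeqP => x; rewrite /= !in_itv/= !andbT gt_max.
  by split => [[-> ->]|/andP[]].
- by move=> n; eexists.
- rewrite -subTset => x _.
  exists (Num.bound `|x|) => //=; rewrite in_itv/= andbT.
  rewrite ltrNl (le_lt_trans (ler_norm _))// normrN.
  exact: archi_boundP.
- by move=> _ [a ->]; exact: munu.
- move=> n; apply: (@le_lt_trans _ _ 1%E); last exact: ltry.
  by apply: probability_le1; exact: measurable_itv.
Qed.

Lemma probability_unique_exp_moments (mu nu : probability T R) (s : R) :
  0 < s ->
  mu.-integrable setT (fun x : T => (expR (s * `|x : R|))%:E) ->
  nu.-integrable setT (fun x : T => (expR (s * `|x : R|))%:E) ->
  (forall n, \int[mu]_x ((x : R) ^+ n) = \int[nu]_x ((x : R) ^+ n)) ->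
  forall A : set T, measurable A -> mu A = nu A.
Proof.
move=> s0 mus nus munu; apply: probability_itv_unique => a.
(* Halving [s] provides the strict inequality [|t| < s] required by [integrable_exprM_expR]. *)
have tE (m : {measure set T -> \bar R}) :
    m.-integrable setT (fun x : T => (expR (s * `|x : R|))%:E) ->
    forall t k, `|t| <= s / 2 -> m.-integrable setT
    (fun x : T => (`|x : R| ^+ k * expR `|t * x|)%:E).
  move=> ms t k ts; apply: integrable_exprM_expR ms _.
  by rewrite (le_lt_trans ts)// ltr_pdivrMr// ltr_pMr// ltr1n.
have tX (m : {measure set T -> \bar R}) :
    m.-integrable setT (fun x : T => (expR (s * `|x : R|))%:E) ->
    forall k, m.-integrable setT (fun x : T => ((x : R) ^+ k)%:E).
  move=> ms k; apply: le_integrable (tE _ ms 0 k _) => //.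
  - by apply/measurable_EFinP; exact: measurable_funX.
  - by move=> x _; rewrite /= mul0r normr0 expR0 mulr1 lee_fin !normrX normr_id.
  - by rewrite normr0 divr_ge0// ltW.
have m1 : moments_agree mu nu (cst 1).
  split=> [|k]; first by split => //; exists 1 => x; rewrite normr1.
  under eq_fun do rewrite mulr1.
  by split; [exact: tX|exact: tX|exact: munu].
have s2 : 0 < s / 2 by rewrite divr_gt0.
(* The indicator multiplies the constant 1 of W; agreement at power 0 is equality of the masses of
   the half-line. *)
have [_ /(_ _ m1)[_ /(_ 0)[_ _]]] := multiplier_itv a s2 (tE _ mus) (tE _ nus).
under eq_Rintegral do rewrite expr0 mul1r mulr1.
under [RHS]eq_Rintegral do rewrite expr0 mul1r mulr1.
rewrite /Rintegral !integral_indic// !setIT => E.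
rewrite -[LHS]fineK ?fin_num_measure// -[RHS]fineK ?fin_num_measure//.
by rewrite E.
Qed.

(** * Growth of the moments under each hypothesis *)

(** For a real [c] strictly between 0 and [l], the normalized terms [b n] are eventually at most 1;
    the finitely many earlier ones are absorbed into [M] as a sum. *)
Lemma moment_bound_root_ratio (m : nat -> R) (l : \bar R) :
  moment_root_ratio m n @[n --> \oo] --> l -> (0 < l)%E ->
  exists c M, 0 < c /\ forall n, `|m n| <= M * n`!%:R / c ^+ n.
Proof.
move=> ml l0.
have [c c0 cl] : exists2 c : R, 0 < c & (c%:E < l)%E.
  case: l l0 {ml} => [r||]//; last by exists 1 => //; exact: ltry.
  rewrite lte_fin => r0; exists (r / 2); first by rewrite divr_gt0.
  by rewrite lte_fin ltr_pdivrMr// ltr_pMr// ltr1n.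
have [N _ NP] : \forall n \near \oo, (c%:E < moment_root_ratio m n)%E.
  exact: ml _ (open_ereal_gt' cl).
pose b n := `|m n| * c ^+ n / n`!%:R.
have b0 n : 0 <= b n by rewrite divr_ge0// mulr_ge0// exprn_ge0// ltW.
(* The strict inequality excludes index 0, where the root is a junk value. *)
have bN n : (N < n)%N -> b n <= 1.
  move=> Nn; have n0 : (0 < n)%N by exact: leq_trans Nn.
  have := NP n (ltnW Nn); rewrite /moment_root_ratio /b.
  have [->|mn0] := eqVneq (m n) 0; first by rewrite normr0 !mul0r.
  rewrite inver (negbTE mn0) -EFinM /= lte_fin.
  set y : R := `|n`!%:R / m n|; rewrite -[ltRHS]/(y `^ n%:R^-1) => cy.
  have yE : (y `^ n%:R^-1) ^+ n = y.
    rewrite -powR_mulrn ?powR_ge0// -powRrM mulVf ?pnatr_eq0 -?lt0n//.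
    by rewrite powRr1 ?normr_ge0.
  have : c ^+ n <= y by rewrite -yE lerXn2r ?nnegrE ?powR_ge0 ?ltW.
  rewrite /y normrM normfV normr_nat ler_pdivlMr ?normr_gt0//.
  by rewrite ler_pdivrMr ?ltr0n ?fact_gt0// mul1r mulrC.
exists c, (1 + \sum_(i < N.+1) b i); split => // n.
rewrite ler_pdivlMr ?exprn_gt0// -ler_pdivrMr ?ltr0n ?fact_gt0// -/(b n).
have [nN|Nn] := ltnP n N.+1.
  rewrite (bigD1 (Ordinal nN))//= addrCA lerDl addr_ge0// sumr_ge0//.
by rewrite (le_trans (bN _ Nn))// lerDl sumr_ge0.
Qed.

(** The terms of the series are bounded at any point [x] of convergence; one with [|x| > 0] gives
    [c = |x|]. *)
Lemma moment_bound_radius (m : nat -> R) :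
  (0 < radius_of_convergence (fun n => m n / n`!%:R)%R)%E ->
  exists c M, 0 < c /\ forall n, `|m n| <= M * n`!%:R / c ^+ n.
Proof.
move=> /ereal_sup_gt[_ [x /= cx <-]]; rewrite lte_fin => x0.
(* Boundedness is stated for every real above a threshold [M], hence the choice of [M + 1]. *)
have [M [_ /(_ (M + 1))]] := cvg_series_bounded cx.
rewrite ltrDl ltr01 => /(_ isT) Mb.
exists `|x|, (M + 1); split => // n.
rewrite ler_pdivlMr ?exprn_gt0// -ler_pdivrMr ?ltr0n ?fact_gt0//.
apply: le_trans (Mb n I); rewrite /= !normrM normfV normr_nat normrX.
by rewrite mulrAC.
Qed.

Lemma finite_moments_integrable (mu : probability T R) : finite_moments mu ->
  forall n, mu.-integrable setT (fun x : T => (`|x : R| ^+ n)%:E).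
Proof.
move=> mum [|n].
  under eq_fun do rewrite expr0.
  apply/integrableP; split; first exact/measurable_EFinP.
  rewrite (eq_integral (cst 1%E)); last by move=> x _; rewrite /= normr1.
  by rewrite integral_cst// mul1e -ge0_fin_numE// fin_num_measure.
apply/integrableP; split.
  by apply/measurable_EFinP; apply: measurable_funX.
under eq_integral do rewrite /= normrX normr_id.
exact: mum.
Qed.

End determinacy.

Theorem theorem2 (R : realType)
    (rho : probability (measurableTypeR R) R)
    (hrho : finite_moments rho)
    (hlim :
      (exists l : \bar R,
         moment_root_ratio (moment rho) n @[n --> \oo] --> l /\ (0 < l)%E)
      \/ (0 < radius_of_convergence (fun n => moment rho n / n`!%:R)%R)%E)
    (rho1 : probability (measurableTypeR R) R)
    (hrho1 : finite_moments rho1)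
    (hmom : forall n : nat, (1 <= n)%N -> moment rho1 n = moment rho n) :
  forall A : set (measurableTypeR R), measurable A -> rho1 A = rho A.
Proof.
(* Equality of moments is assumed from index 1 on; at index 0 both are the total mass. *)
have mom0 (mu : probability (measurableTypeR R) R) : moment mu 0 = 1.
  rewrite /moment; under eq_Rintegral do rewrite expr0.
  have muT : fine (mu setT) = 1 by rewrite (probability_setT mu).
  by rewrite Rintegral_cst// mul1r.
have hmom0 n : moment rho1 n = moment rho n.
  by case: n => [|n]; [rewrite !mom0|exact: hmom].
have [c [M [c0 mM]]] :
    exists c M, 0 < c /\ forall n, `|moment rho n| <= M * n`!%:R / c ^+ n.
  case: hlim => [[l [ml l0]]|]; last exact: moment_bound_radius.
  exact: moment_bound_root_ratio ml l0.
(* Any exponent strictly between 0 and [c] serves both measures, as the bound involves only the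
   common moments. *)
have c2 : 0 < c / 2 < c by rewrite divr_gt0//= ltr_pdivrMr// ltr_pMr// ltr1n.
have [c20 _] := andP c2.
apply: (probability_unique_exp_moments c20).
- apply: (integrable_expR_normM _ _ c2); first exact: finite_moments_integrable.
  by move=> n; have := mM n; rewrite -hmom0; exact.
- apply: (integrable_expR_normM _ _ c2); first exact: finite_moments_integrable.
  exact: mM.
- exact: hmom0.
Qed.
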